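(* Let $r:\mathbb R\to(0,\infty)$ be continuous and let $0\le q\in L_1^{\rm loc}(\mathbb R)$. The problem $$-r(x)y'(x)+q(x)y(x)=f(x),\quad x\in\mathbb R,\qquad \lim_{|x|\to\infty}y(x)=0$$ is correctly solvable in $L_1(\mathbb R)$ if and only if the following three conditions hold together: 1) $\int_{-\infty}^0\frac{q(t)}{r(t)}dt=\infty$; 2) $r_0:=\inf_{x\in\mathbb R}r(x)>0$; 3) $M_1:=\sup_{x\in\mathbb R}M_1(x)<\infty$, where $$M_1(x)=\frac{1}{r(x)}\int_{-\infty}^x\exp\Big(-\int_t^x\frac{q(\xi)}{r(\xi)}d\xi\Big)dt .$$ Moreover, the condition $M_1<\infty$ is necessary and sufficient for the operator $G:L_1(\mathbb R)\to L_1(\mathbb R)$ to be bounded, and $\|G\|_{1\to1}=M_1$.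
   Context: $L_1(\mathbb R)$ is the usual Lebesgue space with norm $\|\cdot\|_1$. A solution of the problem (for given $f\in L_1(\mathbb R)$) is any function $y$ on $\mathbb R$, absolutely continuous on every compact interval, that satisfies the differential equation almost everywhere on $\mathbb R$ and satisfies $y(x)\to0$ as $|x|\to\infty$. The problem is called correctly solvable in $L_1(\mathbb R)$ if (I) for every $f\in L_1(\mathbb R)$ there exists a unique solution $y\in L_1(\mathbb R)$, and (II) there is a constant $c_1\in(0,\infty)$, independent of $f$, such that $\|y\|_1\le c_1\|f\|_1$ for all $f\in L_1(\mathbb R)$. $G$ is the integral operator $(Gf)(x)=\int_x^\infty\frac{1}{r(t)}\exp\big(-\int_x^t\frac{q(s)}{r(s)}ds\big)f(t)\,dt$, $x\in\mathbb R$, and $\|G\|_{1\to1}$ is its operator norm on $L_1(\mathbb R)$. *)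

(* Defs.v *)
From mathcomp Require Import all_boot all_order all_algebra.
From mathcomp Require Import all_classical all_reals all_analysis.

Set Implicit Arguments.
Unset Strict Implicit.
Unset Printing Implicit Defensive.

Import Order.TTheory GRing.Theory Num.Theory.
Import numFieldNormedType.Exports.

Local Open Scope classical_set_scope.
Local Open Scope ring_scope.

Section defs.
Context {R : realType}.

Local Notation mu := (@lebesgue_measure R).

Definition in_L1 (f : R -> R) : Prop := mu.-integrable setT (EFin \o f).

Definition norm1 (f : R -> \bar R) : \bar R := 'N[mu]_1%E[f].

Definition absolutely_continuous (a b : R) (y : R -> R) : Prop :=
  forall e : R, 0 < e -> exists2 d : R, 0 < d &
    forall (n : nat) (u v : 'I_n -> R),
      (forall i, [/\ a <= u i, u i < v i & v i <= b]) ->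
      trivIset setT (fun i => [set` `]u i, v i[]) ->
      \sum_(i < n) (v i - u i) < d ->
      \sum_(i < n) `|y (v i) - y (u i)| < e.

Definition is_solution (r q f y : R -> R) : Prop :=
  [/\ forall a b : R, a <= b -> absolutely_continuous a b y,
      {ae mu, forall x, derivable y x 1 /\ - r x * derive1 y x + q x * y x = f x},
      y x @[x --> -oo] --> 0
    & y x @[x --> +oo] --> 0].

Definition correctly_solvable (r q : R -> R) : Prop :=
  (forall f : R -> R, in_L1 f ->
     exists! y : R -> R, is_solution r q f y /\ in_L1 y) /\
  (exists2 c1 : R, 0 < c1 &
     forall f y : R -> R, in_L1 f -> is_solution r q f y -> in_L1 y ->
       (norm1 (EFin \o y) <= c1%:E * norm1 (EFin \o f))%E).

(* Real-valued: q / r is integrable on [a, b] when q is locally integrable and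
   r is continuous and positive. *)
Definition int_qr (r q : R -> R) (a b : R) : R :=
  \int[mu]_(s in `[a, b]) (q s / r s).

Definition M1_at (r q : R -> R) (x : R) : \bar R :=
  ((r x)^-1%:E * \int[mu]_(t in `]-oo, x]) (expR (- int_qr r q t x))%:E)%E.

Definition M1 (r q : R -> R) : \bar R := ereal_sup (range (M1_at r q)).

Definition G_integrand (r q f : R -> R) (x t : R) : R :=
  (r t)^-1 * expR (- int_qr r q x t) * f t.

(* Extended-real valued, so that a divergent integral is not silently replaced
   by a real number. *)
Definition G (r q f : R -> R) (x : R) : \bar R :=
  (\int[mu]_(t in `[x, +oo[) (G_integrand r q f x t)%:E)%E.

Definition G_maps_L1 (r q : R -> R) : Prop :=
  forall f : R -> R, in_L1 f ->
    {ae mu, forall x, mu.-integrable `[x, +oo[ (EFin \o G_integrand r q f x)} /\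
    mu.-integrable setT (G r q f).

Definition G_bounded (r q : R -> R) : Prop :=
  G_maps_L1 r q /\
  exists C : R, forall f : R -> R, in_L1 f ->
    (norm1 (G r q f) <= C%:E * norm1 (EFin \o f))%E.

Definition G_opnorm (r q : R -> R) : \bar R :=
  ereal_sup [set norm1 (G r q f) |
             f in [set f : R -> R | in_L1 f /\ (norm1 (EFin \o f) <= 1)%E]].

End defs.

(* Main.v *)
Require Import Defs.
From mathcomp Require Import all_boot all_order all_algebra.
From mathcomp Require Import all_classical all_reals all_analysis.
From mathcomp Require Import measurable_realfun ring lra.
Import Order.TTheory GRing.Theory Num.Theory.
Import numFieldNormedType.Exports.
Local Open Scope classical_set_scope.
Local Open Scope ring_scope.

(** Let Q be a primitive of q / r, W = exp (- Q) the integrating factor and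
    k = W / r. Wherever a solution y is differentiable, (W y)' = - k f, so,
    y being absolutely continuous,
      W(a) y(a) - W(b) y(b) = int_a^b k f      (a <= b)
    (solution_weighted). Since q >= 0, W is nonincreasing; hence y -> 0 at +oo
    forces W y -> 0 there, and y(x) = W(x)^-1 int_x^oo k f. This expression is
    exactly (G f)(x), so solutions are unique (solution_unique), and when f >= 0
    they are bounded below by the contribution of any interval [c, d] to the
    right of x (solution_lower_bound).

    In the same notation M_1(c) = k(c) int_(-oo)^c W^-1. Tonelli's theorem turns
    the integral over x of (G |f|)(x) into the integral over t of |f(t)| M_1(t),
    which gives ||G|| <= M_1. For the converse, test G on a unit mass spread over
    a short interval [c, d]: to the left of c, G f is almost k(c) W^-1, because
    k is continuous, so ||G f|| is at least almost M_1(c) (M1_at_le_opnorm).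

    Necessity. The same unit masses, now put on the right-hand side of the
    equation, give y >= const * W^-1 to the left of c with a positive constant.
    As y -> 0 at -oo, W must be unbounded there: this is condition 1. The a priori
    bound on ||y|| gives M_1(c) <= 2 c_1: this is condition 3. If inf r = 0, take
    points a_n with r(a_n) < 2^-(n+1) and let f be a sum of masses 2^-(n+1)
    concentrated just to the right of the a_n; then f is integrable, but
    y(a_n) >= 1/2 for every n. As y vanishes at both ends, the a_n stay in a
    compact interval, on which the continuous function r > 0 is bounded away
    from 0, a contradiction.

    Sufficiency. Since r >= r_0 > 0, the formula above converges for every x and
    defines a solution: it tends to 0 at both ends by dominated convergence with
    the dominating function |f| / r_0, condition 1 being what kills the integrand
    as x -> -oo. The bound on G, which M_1 < oo provides, puts y in L_1 and gives
    the a priori estimate.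

    Two classical facts about absolute continuity carry the argument: an
    absolutely continuous function whose derivative is zero almost everywhere is
    constant (ac_derive0_cst), and the primitive of a locally integrable function
    is absolutely continuous and differentiable almost everywhere with the
    expected derivative (primitive_ac, primitive_derivable). *)

(** * Absolutely continuous functions *)

Section absolute_continuity.
Set Implicit Arguments.
Unset Strict Implicit.
Context {R : realType}.
Implicit Types (f g h : R -> R) (a b : R).
Local Notation mu := (@lebesgue_measure R).

(** A real-line form of Cousin's lemma: the supremum of the points of S in
    [a, b] lies in S and cannot be smaller than b, since near it S propagates
    from left to right. *)
Lemma continuous_induction a b (S : set R) : a <= b -> S a ->
  (forall s, a <= s <= b -> exists2 e, 0 < e &
    forall x y, a <= x <= s -> s <= y <= b -> s - e < x -> y < s + e ->
      S x -> S y) ->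
  S b.
Proof.
move=> ab Sa step.
pose A := [set x | S x /\ a <= x <= b].
have Aa : A a by split=> //; rewrite lexx.
have supA : has_sup A by split; [exists a|exists b => x [_ /andP[]]].
pose s := sup A.
have as_ : a <= s by apply: ub_le_sup => //; case: supA.
have sb : s <= b by apply: ge_sup; [exists a|move=> x [_ /andP[]]].
have [|e e0 He] := step s; first by rewrite as_ sb.
have [x [Sx /andP[ax xb]] sx] := sup_adherent e0 supA.
have xs : x <= s by apply: ub_le_sup; [case: supA|split=> //; rewrite ax xb].
have Sy y : s <= y <= b -> y < s + e -> S y.
  by move=> sy ye; apply: (He x y) => //; rewrite ax xs.
have [sb'|] := ltP s b; last first.
  move=> bs; have -> : b = s by apply/eqP; rewrite eq_le bs sb.
  by apply: Sy; rewrite ?lexx ?sb// ltrDl.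
pose y := Num.min b (s + e / 2).
have sy : s < y by rewrite lt_min sb' ltrDl divr_gt0.
have yb : y <= b by rewrite ge_min lexx.
have : y <= s.
  apply: ub_le_sup; first by case: supA.
  split; last by rewrite yb (le_trans as_ (ltW sy)).
  apply: Sy; first by rewrite (ltW sy).
  by rewrite gt_min ltrD2l ltr_pdivrMr// mulr_natr mulr2n ltrDl e0 orbT.
by rewrite leNgt sy.
Qed.

(** All the stability properties needed below (sums, products, composition
    with a locally Lipschitz function) are instances of this one estimate. *)
Lemma ac_dominated a b (C : R) f g h : 0 <= C ->
  absolutely_continuous a b g -> absolutely_continuous a b h ->
  (forall u v, a <= u -> u < v -> v <= b ->
    `|f v - f u| <= C * (`|g v - g u| + `|h v - h u|)) ->
  absolutely_continuous a b f.
Proof.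
move=> C0 acg ach fgh e e0.
have e2 : 0 < e / (2 * (C + 1)) by apply: divr_gt0 => //; lra.
have [d1 d10 H1] := acg _ e2; have [d2 d20 H2] := ach _ e2.
exists (Num.min d1 d2); first by rewrite lt_min d10.
move=> n u v uv tuv; rewrite lt_min => /andP[l1 l2].
have {H1}s1 := H1 n u v uv tuv l1; have {H2}s2 := H2 n u v uv tuv l2.
apply: (@le_lt_trans _ _ (C * (\sum_(i < n) `|g (v i) - g (u i)| +
                         \sum_(i < n) `|h (v i) - h (u i)|))).
  rewrite -big_split mulr_sumr; apply: ler_sum => i _ /=.
  by have [? ? ?] := uv i; exact: fgh.
apply: (@le_lt_trans _ _ (C * (e / (2 * (C + 1)) + e / (2 * (C + 1))))).
  by rewrite ler_wpM2l// lerD// ltW.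
have -> : C * (e / (2 * (C + 1)) + e / (2 * (C + 1))) = e * (C / (C + 1)).
  by field; lra.
by rewrite gtr_pMr// ltr_pdivrMr; lra.
Qed.

Lemma ac_increment a b f e : absolutely_continuous a b f -> 0 < e ->
  exists2 d, 0 < d & forall u v, a <= u -> u <= v -> v <= b -> v - u < d ->
    `|f v - f u| < e.
Proof.
move=> acf e0; have [d d0 H] := acf e e0; exists d => // u v au uv vb uvd.
move: uv; rewrite le_eqVlt => /predU1P[->|uv]; first by rewrite subrr normr0.
have := H 1%N (fun=> u) (fun=> v); rewrite !big_ord1; apply => //.
by move=> i j _ _ _; rewrite (ord1 i) (ord1 j).
Qed.

Lemma ac_continuous f : (forall a b, a <= b -> absolutely_continuous a b f) ->
  continuous f.
Proof.
move=> acf x; apply/cvgrPdist_lt => e e0.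
have [|d d0 H] := @ac_increment (x - 1) (x + 1) f e _ e0; first by apply: acf; lra.
have m0 : 0 < Num.min d 1 by rewrite lt_min d0 ltr01.
near=> y.
have yx : `|x - y| < Num.min d 1.
  by near: y; exact: (nbhsx_ballx x _ m0).
move: yx; rewrite lt_min => /andP[yd y1].
have [xy|yx] := leP x y; [rewrite distrC|]; apply: H;
  move: yd y1; rewrite !ltr_norml => /andP[? ?] /andP[? ?]; lra.
Unshelve. all: by end_near. Qed.

Lemma continuous_bounded a b f : continuous f ->
  exists2 C, 0 <= C & forall x, a <= x <= b -> `|f x| <= C.
Proof.
move=> cf; have [ab|ba] := leP a b; last first.
  by exists 0 => // x /andP[ax xb]; have := le_lt_trans (le_trans ax xb) ba; rewrite ltxx.
have [|c _ cM] := @EVT_max R (fun x => `|f x|) a b ab.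
  apply: continuous_subspaceT => x; apply: continuous_comp; first exact: cf.
  exact: norm_continuous.
by exists `|f c| => // x xab; apply: cM; rewrite in_itv.
Qed.

Lemma ac_add a b f g : absolutely_continuous a b f ->
  absolutely_continuous a b g -> absolutely_continuous a b (fun x => f x + g x).
Proof.
move=> acf acg; apply: (@ac_dominated a b 1 _ f g) => // u v _ _ _.
have -> : f v + g v - (f u + g u) = (f v - f u) + (g v - g u) by ring.
by rewrite mul1r ler_normD.
Qed.

Lemma ac_mul f g : (forall a b, a <= b -> absolutely_continuous a b f) ->
  (forall a b, a <= b -> absolutely_continuous a b g) ->
  forall a b, a <= b -> absolutely_continuous a b (fun x => f x * g x).
Proof.
move=> acf acg a b ab.
have [C C0 fC] := continuous_bounded a b (ac_continuous acf).
have [D D0 gD] := continuous_bounded a b (ac_continuous acg).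
apply: (@ac_dominated a b (C + D) _ f g); [lra|exact: acf|exact: acg|].
move=> u v au uv vb.
have -> : f v * g v - f u * g u = f v * (g v - g u) + g u * (f v - f u) by ring.
rewrite (le_trans (ler_normD _ _))// !normrM mulrDr addrC lerD//.
  rewrite ler_wpM2r// (le_trans (gD _ _)) ?lerDr//.
  by rewrite au; lra.
rewrite ler_wpM2r// (le_trans (fC _ _)) ?lerDl//.
by rewrite vb; lra.
Qed.

(** On a compact interval f is bounded, and exp is Lipschitz on bounded
    sets; the Lipschitz bound comes from 1 + x <= exp x. *)
Lemma ac_expR f : (forall a b, a <= b -> absolutely_continuous a b f) ->
  forall a b, a <= b -> absolutely_continuous a b (fun x => expR (f x)).
Proof.
move=> acf a b ab.
have [C C0 fC] := continuous_bounded a b (ac_continuous acf).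
apply: (@ac_dominated a b (expR C) _ f f); rewrite ?expR_ge0//; [exact: acf|exact: acf|].
have key s t : `|s| <= C -> expR s - expR t <= expR C * `|s - t|.
  move=> sC.
  have -> : expR t = expR s * expR (t - s) by rewrite -expRD; congr expR; ring.
  apply: (@le_trans _ _ (expR s * (s - t))).
    have := expR_ge1Dx (t - s); have := expR_gt0 s; nra.
  apply: (@le_trans _ _ (expR s * `|s - t|)).
    by rewrite ler_wpM2l ?expR_ge0// ler_norm.
  by rewrite ler_wpM2r// ler_expR (le_trans _ sC)// ler_norm.
move=> u v au uv vb.
have fu := fC u _; have fv := fC v _.
apply: (@le_trans _ _ (expR C * `|f v - f u|)).
  rewrite ler_norml; apply/andP; split.
    by rewrite lerNl opprB distrC key// fu// au; lra.
  by rewrite key// fv// vb; lra.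
by rewrite ler_wpM2l ?expR_ge0// lerDl.
Qed.

(** The exceptional null set is covered by an open set U that is shorter than
    the modulus of absolute continuity for e. Walking from a to b by continuous
    induction, every small step either stays in U or has slope at most e; the
    steps inside U are pairwise disjoint, so together they contribute less
    than e. *)
Lemma ac_derive0_cst a b f : a <= b -> absolutely_continuous a b f ->
  {ae mu, forall x, derivable f x 1 /\ derive1 f x = 0} -> f b = f a.
Proof.
move=> ab acf aeD.
pose D := [set x | derivable f x 1 /\ derive1 f x = 0].
apply/eqP; rewrite -subr_eq0 -normr_le0; apply/ler_addgt0Pl => e0' e0'0.
rewrite addr0.
(* The steps of small slope cost e * (b - a), those inside U cost e. *)
pose e := e0' / (b - a + 1).
have e0 : 0 < e by rewrite divr_gt0//; lra.
have [d d0 acd] := acf _ e0.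
have [U [oU NU muU]] : exists U, [/\ open U, ~` D `<=` U & (mu U < d%:E)%E].
  have d2 : 0 < d / 2 by lra.
  have [U [oU NU muU]] := outer_measure_open_le (~` D) d2.
  exists U; split=> //; apply: (le_lt_trans muU).
  move/negligible_outer_measure: aeD => ->.
  by rewrite add0e lte_fin; lra.
pose ok (L : seq (R * R)) (x : R) := forall p : R * R, p \in L ->
  [/\ a <= p.1, p.1 < p.2, p.2 <= x & [set` `]p.1, p.2[] `<=` U].
(* L lists the steps made inside U, the most recent, rightmost one first. *)
pose S (x : R) := exists L : seq (R * R), [/\ ok L x,
  pairwise (fun p q : R * R => q.2 <= p.1) L &
  `|f x - f a| <= e * (x - a) + \sum_(p <- L) `|f p.2 - f p.1|].
have SM x y : x <= y -> `|f y - f x| <= e * (y - x) -> S x -> S y.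
  move=> xy fxy [L [okL pL fL]]; exists L; split=> //.
    by move=> p /okL[? ? ? ?]; split=> //; lra.
  have -> : f y - f a = (f y - f x) + (f x - f a) by ring.
  by rewrite (le_trans (ler_normD _ _))//; lra.
have SU x y : a <= x -> x <= y -> [set` `]x, y[] `<=` U -> S x -> S y.
  move=> ax; rewrite le_eqVlt => /predU1P[<-//|xy] xyU [L [okL pL fL]].
  exists ((x, y) :: L); split=> //.
  - move=> p; rewrite in_cons => /predU1P[->/=|/okL[? ? ? ?]].
      by split=> //; lra.
    by split=> //; lra.
  - by rewrite /= pL andbT; apply/allP => p /okL[].
  - rewrite big_cons /=.
    have -> : f y - f a = (f y - f x) + (f x - f a) by ring.
    rewrite (le_trans (ler_normD _ _))//.
    rewrite addrCA lerD2l (le_trans fL)// lerD2r ler_wpM2l//; first exact: ltW.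
    by lra.
suff [L [okL pL fL]] : S b.
  pose n := size L; pose u i := (nth (0, 0) L i).1; pose v i := (nth (0, 0) L i).2.
  have sumE (F : R * R -> R) :
      \sum_(p <- L) F p = \sum_(i < n) F (nth (0, 0) L i).
    by rewrite (big_nth (0, 0)) big_mkord.
  have okn (i : 'I_n) := okL _ (mem_nth (0, 0) (ltn_ord i)).
  have tuv : trivIset setT (fun i : 'I_n => [set` `]u i, v i[]).
    move=> i j _ _ [x [/=]]; rewrite !in_itv/= => /andP[ui vi] /andP[uj vj].
    have sep (k l : 'I_n) : (k < l)%N -> v l <= u k.
      by move: pL => /(pairwiseP (0, 0)) pL kl; apply: pL; rewrite ?inE.
    apply/val_inj; case: (ltngtP i j) => // ij; exfalso;
      by have := sep _ _ ij; lra.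
  have : \sum_(i < n) `|f (v i) - f (u i)| < e.
    apply: acd => //; first by move=> i; have [? ? ? ?] := okn i.
    rewrite -lte_fin; apply: le_lt_trans muU.
    rewrite -sumEFin.
    have -> : (\sum_(i < n) (v i - u i)%:E)%E =
        (\sum_(i < n) mu [set` `]u i, v i[])%E.
      apply: eq_bigr => i _; have [_ uv _ _] := okn i.
      by rewrite lebesgue_measure_itv/= lte_fin uv.
    rewrite -measure_bigsetU_ord//.
    apply: le_measure; rewrite ?inE.
    - by apply: bigsetU_measurable => i _; exact: measurable_itv.
    - exact: open_measurable.
    - rewrite -bigcup_seq; move=> x [i _ xi].
      by have [_ _ _] := okn i; exact.
  rewrite -(sumE (fun p => `|f p.2 - f p.1|)) => sume.
  apply: (le_trans fL); rewrite (_ : e0' = e * (b - a) + e).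
    by rewrite lerD2l ltW.
  by rewrite /e; field; lra.
apply: (@continuous_induction a b S) => //.
  by exists [::]; split=> //; rewrite big_nil !subrr normr0 mulr0 addr0.
move=> s /andP[as_ sb].
have [Ds|nDs] := pselect (D s); last first.
  have : nbhs s U by apply: open_nbhs_nbhs; split => //; exact: NU.
  move=> /nbhs_ballP[eta /= eta0 sU]; exists eta => // x y /andP[ax xs] /andP[sy yb].
  move=> xeta yeta Sx; apply: (SU x) => //; first lra.
  move=> z /=; rewrite in_itv/= => /andP[xz zy]; apply: sU.
  by rewrite /ball/= ltr_norml; apply/andP; split; lra.
have [ds d0s] := Ds.
have : h^-1 *: (f (h + s) - f s) @[h --> 0^'] --> (0 : R).
  move: d0s; rewrite derive1E => d0s.
  have /cvg_ex[l hl] := ds.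
  have l0 : l = 0.
    by rewrite -d0s; apply/esym/cvg_lim => //; exact: Rhausdorff.
  rewrite l0 in hl.
  apply: cvg_trans hl; apply: near_eq_cvg; near=> k.
  by rewrite /= [k%:A]mulr1.
move=> /cvgrPdist_le /(_ _ e0).
rewrite near_withinE => /nbhs_ballP[eta /= eta0 sH].
have slope t : `|t - s| < eta -> `|f t - f s| <= e * `|t - s|.
  move=> ts; have [->|tns] := eqVneq t s; first by rewrite !subrr normr0 mulr0.
  have := sH (t - s); rewrite /ball/= sub0r normrN => /(_ ts).
  rewrite subr_eq0 => /(_ tns); rewrite subrK sub0r normrN.
  rewrite normrZ normfV mulrC ler_pdivrMr//.
  by rewrite normr_gt0 subr_eq0.
exists eta => // x y /andP[ax xs] /andP[sy yb] xe ye.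
apply: SM; first lra.
have -> : f y - f x = (f y - f s) - (f x - f s) by ring.
rewrite (le_trans (ler_normB _ _))//.
have -> : e * (y - x) = e * `|y - s| + e * `|x - s|.
  by rewrite (ger0_norm (_ : 0 <= y - s)) ?(ler0_norm (_ : x - s <= 0)); [ring|lra|lra].
by rewrite lerD// slope// ltr_norml; lra.
Unshelve. all: by end_near. Qed.

End absolute_continuity.

(** * Primitives of locally integrable functions *)

Section primitive.
Set Implicit Arguments.
Unset Strict Implicit.
Context {R : realType}.
Implicit Types (f g h : R -> R) (a b : R).
Local Notation mu := (@lebesgue_measure R).
Local Notation locint := (locally_integrable [set: R]).

Lemma ae_imply (P Q : R -> Prop) : (forall x, P x -> Q x) ->
  {ae mu, forall x, P x} -> {ae mu, forall x, Q x}.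
Proof. by move=> PQ; apply: filterS => //; exact: (ae_filter_ringOfSetsType mu). Qed.

Lemma ae_imply2 (P Q S : R -> Prop) : (forall x, P x -> Q x -> S x) ->
  {ae mu, forall x, P x} -> {ae mu, forall x, Q x} -> {ae mu, forall x, S x}.
Proof. by move=> PQ; apply: filterS2 => //; exact: (ae_filter_ringOfSetsType mu). Qed.

Lemma locint_measurable g : locint g -> measurable_fun setT g.
Proof. by case. Qed.

Lemma locint_itv g a b : locint g -> mu.-integrable `[a, b] (EFin \o g).
Proof.
move=> [mg _ fin]; apply/integrableP; split.
  by apply/measurable_EFinP; exact: measurable_funS mg.
by apply: fin => //; exact: segment_compact.
Qed.

Lemma locint_L1 f : in_L1 f -> locint f.
Proof. by move=> L1f; apply: open_integrable_locally => //; exact: openT. Qed.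

Lemma L1_measurable f : in_L1 f -> measurable_fun setT f.
Proof. by move=> /locint_L1/locint_measurable. Qed.

Lemma locint_mul_continuous (c : R -> R) g : continuous c -> locint g ->
  locint (fun x => c x * g x).
Proof.
move=> cc lg; have [mg oT fin] := lg; split=> //.
  by apply: measurable_funM => //; exact: continuous_measurable_fun.
move=> K _ cK.
have mK : measurable K by exact: compact_measurable.
have gK : mu.-integrable K (EFin \o g).
  apply/integrableP; split; last exact: fin.
  by apply/measurable_EFinP; exact: measurable_funS mg.
have : mu.-integrable K ((EFin \o c) \* (EFin \o g))%E.
  apply: integrableMr => //.
    by apply: measurable_funS (continuous_measurable_fun cc).
  have : compact (c @` K) by apply: continuous_compact => //; exact: continuous_subspaceT.
  move=> /compact_bounded [M [Mr HM]]; exists M; split=> // y My x Kx.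
  by apply: HM => //; exists x.
by case/integrableP => _; under eq_integral do rewrite abseM -EFinM -normrM.
Qed.

(** Absolute continuity of the integral: a truncation of |g| at height N is
    harmless on a small set, and what it cuts off has small integral. *)
Lemma integral_small_set (D : set R) g e : measurable D ->
  mu.-integrable D (EFin \o g) -> 0 < e ->
  exists2 d, 0 < d & forall A, measurable A -> A `<=` D -> (mu A < d%:E)%E ->
    (\int[mu]_(x in A) `|(g x)%:E| < e%:E)%E.
Proof.
move=> mD ig e0.
have mg : measurable_fun D g by apply/measurable_EFinP; case/integrableP: ig.
pose h x := `|g x|.
have mh : measurable_fun D h by exact: measurableT_comp.
pose hn n x := Num.min (h x) n%:R.
have mhn n : measurable_fun D (hn n) by exact: measurable_minr.
have [_ H _] : [/\ mu.-integrable D (EFin \o h),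
    [sequence \int[mu]_(x in D) `|(hn n x)%:E - (h x)%:E|]_n @ \oo --> 0%E &
    [sequence \int[mu]_(x in D) ((hn n x)%:E)]_n @ \oo --> \int[mu]_(x in D) (h x)%:E]%E.
  apply: (@dominated_convergence _ _ _ mu D mD (fun n => EFin \o hn n) (EFin \o h) (EFin \o h)).
  - by move=> n; apply/measurable_EFinP; exact: mhn.
  - by apply/measurable_EFinP.
  - apply: aeW => x _; apply: cvg_near_cst.
    near=> n; rewrite /= /hn min_l//.
    near: n; exact: nbhs_infty_ger.
  - exact: integrable_norm.
  - apply: aeW => x n _ /=; rewrite lee_fin ger0_norm ?le_min ?normr_ge0 ?ler0n//.
    by rewrite ge_min lexx.
have e2 : 0 < e / 2 by lra.
have [N _ HN] : \forall n \near \oo,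
    (\int[mu]_(x in D) `|(hn n x)%:E - (h x)%:E| < (e / 2)%:E)%E.
  move/fine_cvgP : H => [H1 /cvgrPdist_lt /(_ _ e2)].
  apply: filterS2 H1 => n finn; rewrite sub0r normrN => lte2.
  by rewrite -[ltLHS]fineK// lte_fin (le_lt_trans (ler_norm _) lte2).
have {}HN := HN N (leqnn N).
exists (e / 2 / N.+1%:R); first by rewrite divr_gt0.
move=> A mA AD muA.
have mS (k : R -> \bar R) : measurable_fun D k -> measurable_fun A k.
  by move=> mk; exact: measurable_funS mk.
have md : measurable_fun D (fun x => `|(hn N x)%:E - (h x)%:E|%E).
  by apply: measurableT_comp => //; apply/measurable_EFinP/measurable_funB.
apply: (@le_lt_trans _ _ (\int[mu]_(x in A) (N.+1%:R%:E + `|(hn N x)%:E - (h x)%:E|))%E).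
  apply: ge0_le_integral => //.
  - by apply: mS; apply: measurableT_comp => //; exact/measurable_EFinP.
  - apply: emeasurable_funD => //; exact: mS.
  - move=> x Ax /=; rewrite lee_fin -lerBlDr.
    have hle : hn N x <= N.+1%:R by rewrite ge_min ler_nat leqnSn orbT.
    rewrite distrC; apply: (le_trans _ hle); rewrite lerBlDr addrC -lerBlDr.
    exact: ler_norm.
rewrite ge0_integralD//; last exact: mS.
rewrite integral_cst//.
apply: (@lt_le_trans _ _ ((e / 2)%:E + (e / 2)%:E)%E); last first.
  by rewrite -EFinD lee_fin; lra.
apply: lteD; first by rewrite muleC -lte_pdivlMr.
by apply: le_lt_trans HN; exact: ge0_subset_integral.
Unshelve. all: by end_near. Qed.

Lemma Rintegral_itv_cat g a b c : locint g -> a <= b -> b <= c ->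
  \int[mu]_(t in `[a, c]) g t =
  \int[mu]_(t in `[a, b]) g t + \int[mu]_(t in `[b, c]) g t.
Proof.
move=> lg ab bc.
have := @Rintegral_itvB R g (BLeft a) (BRight c) b (locint_itv _ _ lg).
rewrite !bnd_simp => /(_ ab bc).
rewrite Rintegral_itv_obnd_cbnd; last first.
  by apply: (integrableS _ _ _ (locint_itv b c lg)) => //; exact: subset_itv_oc_cc.
by move=> <-; ring.
Qed.

(** At least one of the two intervals is empty or a single point, so this is the
    integral of g from 0 to x with its orientation. *)
Definition primitive g x : R :=
  \int[mu]_(t in `[0, x]) g t - \int[mu]_(t in `[x, 0]) g t.

Lemma Rintegral_itv_ge g a b : b <= a -> \int[mu]_(t in `[a, b]) g t = 0.
Proof.
rewrite le_eqVlt => /predU1P[->|ba]; first by rewrite set_itv1 Rintegral_set1.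
by rewrite set_itv_ge ?Rintegral_set0// bnd_simp -ltNge.
Qed.

Lemma primitiveB g a b : locint g -> a <= b ->
  primitive g b - primitive g a = \int[mu]_(t in `[a, b]) g t.
Proof.
move=> lg ab; rewrite /primitive.
have [a0|a0] := leP 0 a.
  rewrite (Rintegral_itv_ge _ a0) (Rintegral_itv_ge _ (le_trans a0 ab)).
  by rewrite (Rintegral_itv_cat lg a0 ab); ring.
have [b0|b0] := leP b 0.
  rewrite (Rintegral_itv_ge _ b0) (Rintegral_itv_ge _ (ltW a0)).
  by rewrite (Rintegral_itv_cat lg ab b0); ring.
rewrite (Rintegral_itv_ge _ (ltW b0)) (Rintegral_itv_ge _ (ltW a0)).
by rewrite (Rintegral_itv_cat lg (ltW a0) (ltW b0)); ring.
Qed.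

Lemma primitive_ac g : locint g -> forall a b, a <= b ->
  absolutely_continuous a b (primitive g).
Proof.
move=> lg a b ab e e0.
have [d d0 H] := integral_small_set (measurable_itv `[a, b]) (locint_itv a b lg) e0.
exists d => // n u v uv tuv sd.
pose A := \big[setU/set0]_(i < n) [set` `]u i, v i[].
have mA : measurable A by apply: bigsetU_measurable => i _; exact: measurable_itv.
have muA : (mu A < d%:E)%E.
  have -> : mu A = (\sum_(i < n) mu [set` `]u i, v i[])%E.
    by rewrite -measure_bigsetU_ord.
  rewrite (eq_bigr (fun i => (v i - u i)%:E)); first by rewrite sumEFin lte_fin.
  move=> i _; have [_ uvi _] := uv i.
  by rewrite lebesgue_measure_itv/= lte_fin uvi.
have AD : A `<=` `[a, b].
  rewrite /A -bigcup_seq => x [i _ /=]; rewrite !in_itv/= => /andP[ux xv].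
  by have [? _ ?] := uv i; lra.
have := H A mA AD muA; rewrite -lte_fin; apply: le_lt_trans.
rewrite /A ge0_integral_bigsetU//; last 3 first.
- exact: index_enum_uniq.
- by apply: sub_trivIset tuv.
- apply: measurableT_comp => //.
  by apply/measurable_EFinP; apply: measurable_funS (locint_measurable lg).
rewrite -sumEFin; apply: lee_sum => i _; have [aui uvi vib] := uv i.
rewrite primitiveB//; last exact: ltW.
rewrite EFin_normr_Rintegral//; last exact: locint_itv.
rewrite -(@integral_itv_bndoo R (u i) (v i) (fun x => `|(g x)%:E|%E) true false).
apply: le_abse_integral => //.
  by apply/measurable_EFinP; apply: measurable_funS (locint_measurable lg).
apply: measurableT_comp => //.
by apply/measurable_EFinP; apply: measurable_funS (locint_measurable lg).
Qed.

Lemma is_derive1P f (x l : R) : is_derive x 1 f l <-> derivable f x 1 /\ derive1 f x = l.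
Proof.
split=> [[df fl]|[df <-]]; first by rewrite derive1E.
by apply: DeriveDef; [exact: df|rewrite derive1E].
Qed.

(** Lebesgue differentiation applies to integrals from a fixed left end -n;
    letting n range over the naturals covers the whole line. *)
Lemma primitive_derivable g : locint g ->
  {ae mu, forall x, derivable (primitive g) x 1 /\ derive1 (primitive g) x = g x}.
Proof.
move=> lg.
have : {ae mu, forall x, forall n, - n%:R < x ->
    derivable (primitive g) x 1 /\ derive1 (primitive g) x = g x}.
  apply/ae_foralln => n.
  have := @FTC1 R g (BLeft (- n%:R)) (fun y => locint_itv _ _ lg) lg.
  apply: ae_imply => x /= + nx => /(_ _)[]; first by rewrite lte_fin.
  set F := (F in derivable F _ _) => dF F'; apply/is_derive1P.
  have {F'}dF : is_derive x 1 F (g x) by apply/is_derive1P.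
  have FE : \forall y \near x, F y + primitive g (- n%:R) = primitive g y.
    near=> y; rewrite /F /= -primitiveB ?subrK//.
    by near: y; exact: (cvgr_ge x (cvg_id : id @ x --> x)).
  apply: (near_eq_is_derive FE).
  rewrite -[X in is_derive _ _ _ X](addr0 (g x)).
  exact: is_deriveD dF (is_derive_cst _ _ _).
apply: ae_imply => x /(_ (Num.truncn `|x|).+1); apply.
by rewrite ltrNl (le_lt_trans (ler_norm _))// normrN truncnS_gt.
Unshelve. all: by end_near. Qed.

Lemma primitive_nondecreasing g a b : locint g -> {ae mu, forall x, 0 <= g x} ->
  a <= b -> primitive g a <= primitive g b.
Proof.
move=> lg g0 ab; rewrite -subr_ge0 primitiveB// /Rintegral.
rewrite (@ae_eq_integral _ _ _ mu `[a, b] (fun x => `|(g x)%:E|%E))//.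
- by rewrite fine_ge0// integral_ge0.
- by apply/measurable_EFinP; apply: measurable_funS (locint_measurable lg).
- apply: measurableT_comp => //.
  by apply/measurable_EFinP; apply: measurable_funS (locint_measurable lg).
- by apply: ae_imply g0 => x g0 _ /=; rewrite ger0_norm.
Qed.

End primitive.

(** * Unit bumps and elementary calculus *)

Section calculus.
Set Implicit Arguments.
Unset Strict Implicit.
Context {R : realType}.
Implicit Types (f y : R -> R) (a b c d x : R).
Local Notation mu := (@lebesgue_measure R).

Lemma is_derive_expR_comp (u : R -> R) x l : is_derive x 1 u l ->
  is_derive x 1 (fun x => expR (u x)) (expR (u x) * l).
Proof.
move=> du; have := @is_derive1_comp R expR u x _ _ (is_derive_expR (u x)) du.
exact.
Qed.

(** Used to confine points where a solution is not small to a compact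
    interval. *)
Lemma large_values_bounded (y : R -> R) e : 0 < e ->
  y x @[x --> -oo] --> 0 -> y x @[x --> +oo] --> 0 ->
  exists2 A, 0 <= A & forall x, e <= `|y x| -> - A <= x <= A.
Proof.
move=> e0 /cvgr0Pnorm_lt/(_ _ e0)[a [_ ya]] /cvgr0Pnorm_lt/(_ _ e0)[b [_ yb]].
exists (Num.max `|a| `|b|); first by rewrite le_max normr_ge0.
move=> x ey; apply/andP; split; rewrite leNgt; apply/negP => xA.
  suff : `|y x| < e by rewrite ltNge ey.
  apply: ya; apply: (lt_le_trans xA).
  by rewrite lerNl le_max -normrN ler_norm.
suff : `|y x| < e by rewrite ltNge ey.
by apply: yb; apply: le_lt_trans xA; rewrite le_max ler_norm orbT.
Qed.

Definition bump c d x : R := (d - c)^-1 * \1_`[c, d] x.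

Lemma bump_ge0 c d x : c < d -> 0 <= bump c d x.
Proof. by move=> cd; rewrite mulr_ge0// invr_ge0 subr_ge0 ltW. Qed.

Lemma bump_L1 c d : in_L1 (bump c d).
Proof.
rewrite /in_L1; have := @integrable_indic_itv R c d true false.
by move=> /(integrableZl measurableT (d - c)^-1).
Qed.

Lemma integral_bump c d : c < d -> (\int[mu]_t (bump c d t)%:E = 1)%E.
Proof.
move=> cd; rewrite [LHS](_ : _ = \int[mu]_t ((d - c)^-1%:E * (\1_`[c, d] t)%:E))%E//.
rewrite ge0_integralZl_EFin//; last 2 first.
- exact/measurable_EFinP.
- by rewrite invr_ge0 subr_ge0 ltW.
rewrite integral_indic// setIT [X in (_ * X)%E]lebesgue_measure_itv/= lte_fin cd -EFinD -EFinM mulVf//.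
by rewrite subr_eq0 gt_eqF.
Qed.

Lemma norm1_bump c d : c < d -> norm1 (EFin \o bump c d) = 1%E.
Proof.
move=> cd; rewrite /norm1 Lnorm1 -(integral_bump cd); apply: eq_integral => t _ /=.
by rewrite ger0_norm// bump_ge0.
Qed.

Lemma Rintegral_bump c d : c < d -> \int[mu]_(t in `[c, d]) bump c d t = 1.
Proof.
move=> cd; rewrite Rintegral_mkcond /Rintegral -[RHS]/(fine 1%E) -(integral_bump cd).
congr fine; apply: eq_integral => t _; rewrite patchE /bump indicE.
by case: ifPn => [->//|_]; rewrite mulr0.
Qed.

(** The sum of the bumps of mass c n on [a n, d n] may be infinite on a null set;
    resetting it to 0 there changes no integral and makes f
    real-valued. *)
Lemma bump_series (a d c : nat -> R) : (forall n, a n < d n) ->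
  (forall n, 0 <= c n) -> (\sum_(n <oo) (c n)%:E < +oo)%E ->
  exists f : R -> R, [/\ in_L1 f, forall t, 0 <= f t &
    forall n, c n <= \int[mu]_(t in `[a n, d n]) f t].
Proof.
move=> ad c0 csum.
pose u n t : \bar R := ((c n)%:E * (bump (a n) (d n) t)%:E)%E.
have u0 n t : (0 <= u n t)%E by rewrite mule_ge0// lee_fin// bump_ge0.
have mu_ n : measurable_fun setT (u n).
  by apply: emeasurable_funM => //; exact: measurable_int (bump_L1 _ _).
pose F t : \bar R := (\sum_(n <oo) u n t)%E.
have F0 t : (0 <= F t)%E by exact: nneseries_ge0.
have uF n t : (u n t <= F t)%E.
  apply: le_trans (nneseries_lim_ge n.+1 _) => //.
  by rewrite big_nat_recr//= leeDr// sume_ge0.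
have mF : measurable_fun setT F.
  by apply: ge0_emeasurable_sum.
have iF : mu.-integrable setT F.
  apply/integrableP; split=> //.
  under eq_integral do rewrite gee0_abs//.
  rewrite integral_nneseries//.
  apply: le_lt_trans csum; apply: lee_nneseries => [n _ _|n _]; first exact: integral_ge0.
  rewrite ge0_integralZl_EFin ?integral_bump ?mule1//.
  - by move=> t _; rewrite lee_fin bump_ge0.
  - exact: measurable_int (bump_L1 _ _).
have mf : measurable_fun setT (fine \o F) by exact: measurableT_comp.
exists (fine \o F); split.
- apply: (le_integrable _ _ _ iF) => //.
    exact/measurable_EFinP.
  by move=> t _ /=; case: (F t) => //=; rewrite normr0 leey.
- by move=> t; exact: fine_ge0.
move=> n; rewrite /Rintegral.
have -> : (\int[mu]_(t in `[a n, d n]) (fine (F t))%:E =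
           \int[mu]_(t in `[a n, d n]) F t)%E.
  apply: ae_eq_integral => //.
  - by apply/measurable_EFinP; exact: measurable_funTS.
  - exact: measurable_funTS.
  - apply: ae_imply (integrable_ae measurableT iF) => t Ft _ /=.
    rewrite fineK//; exact: Ft.
have iFn : mu.-integrable `[a n, d n] F by exact: integrableS iF.
rewrite -lee_fin fineK; last exact: integrable_fin_num.
rewrite -[leLHS]mule1.
have -> : (1%E = \int[mu]_(t in `[a n, d n]) (bump (a n) (d n) t)%:E)%E.
  rewrite -[LHS]/(1%:E) -(Rintegral_bump (ad n)) /Rintegral fineK//.
  apply: integrable_fin_num => //.
  by apply: (integrableS _ _ _ (bump_L1 (a n) (d n))).
rewrite -ge0_integralZl_EFin//.
- apply: ge0_le_integral => //.
  + by move=> t _; exact: u0.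
  + by apply: measurable_funTS; exact: mu_.
  + exact: measurable_funTS.
  + by move=> t _; exact: uF.
- by move=> t _; rewrite lee_fin bump_ge0.
- by apply: measurable_funTS; exact: measurable_int (bump_L1 _ _).
Qed.

End calculus.

(** * The integrating factor *)

Section problem.
Set Implicit Arguments.
Unset Strict Implicit.
Context {R : realType} (r q : R -> R).
Hypothesis r_cont : continuous r.
Hypothesis r_gt0 : forall x, 0 < r x.
Hypothesis q_loc : locally_integrable [set: R] q.
Hypothesis q_ge0 : {ae (@lebesgue_measure R), forall x, 0 <= q x}.
Implicit Types (f y : R -> R) (a b c x : R).
Local Notation mu := (@lebesgue_measure R).
Local Notation locint := (locally_integrable [set: R]).

Let p x := q x / r x.
Definition potential := primitive p.
Local Notation Q := potential.
Definition weight x := expR (- Q x).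
Local Notation W := weight.

(** The kernel of G is k(t) / W(x) for x <= t: it splits into a factor
    depending on t and one depending on x. *)
Definition density x := W x / r x.
Local Notation k := density.

Lemma invr_continuous : continuous (fun x => (r x)^-1).
Proof. by move=> x; apply: (@continuousV _ _ r x); [rewrite gt_eqF|exact: r_cont]. Qed.

Lemma locint_qr : locint p.
Proof.
have := locint_mul_continuous invr_continuous q_loc.
by congr (locally_integrable _ _); apply/funext => x; rewrite mulrC.
Qed.

Lemma qr_ge0 : {ae mu, forall x, 0 <= p x}.
Proof. by apply: ae_imply q_ge0 => x qx; rewrite divr_ge0// ltW. Qed.

Lemma potential_nondecreasing a b : a <= b -> Q a <= Q b.
Proof. exact: primitive_nondecreasing locint_qr qr_ge0. Qed.

Lemma potential_ac a b : a <= b -> absolutely_continuous a b Q.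
Proof. exact: primitive_ac locint_qr _ _. Qed.

Lemma potentialN_ac a b : a <= b -> absolutely_continuous a b (fun x => - Q x).
Proof.
move=> ab; apply: (ac_dominated ler01 (potential_ac ab) (potential_ac ab)) => u v _ _ _.
by rewrite mul1r opprK addrC distrC lerDl.
Qed.

Lemma int_qrE a b : a <= b -> int_qr r q a b = Q b - Q a.
Proof. by move=> ab; rewrite primitiveB//; exact: locint_qr. Qed.

Lemma weight_gt0 x : 0 < W x. Proof. exact: expR_gt0. Qed.

Lemma weight_nonincreasing a b : a <= b -> W b <= W a.
Proof. by move=> ab; rewrite ler_expR lerN2 potential_nondecreasing. Qed.

Lemma weight_ac a b : a <= b -> absolutely_continuous a b W.
Proof. by apply: ac_expR => c d; exact: potentialN_ac. Qed.

Lemma weight_continuous : continuous W.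
Proof. by apply: ac_continuous => a b; exact: weight_ac. Qed.

Lemma weightV x : (W x)^-1 = expR (Q x).
Proof. by rewrite /W expRN invrK. Qed.

Lemma weightV_ac a b : a <= b -> absolutely_continuous a b (fun x => (W x)^-1).
Proof. by rewrite (eq_fun weightV); apply: ac_expR => c d; exact: potential_ac. Qed.

Lemma measurable_weightV (D : set R) : measurable_fun D (fun x => (W x)^-1).
Proof.
apply: measurable_funTS; apply: continuous_measurable_fun.
by apply: ac_continuous => a b; exact: weightV_ac.
Qed.

Lemma expR_int_qr a b : a <= b -> expR (- int_qr r q a b) = (W a)^-1 * W b.
Proof. by move=> ab; rewrite int_qrE// weightV -expRD; congr expR; ring. Qed.

Lemma density_gt0 x : 0 < k x. Proof. by rewrite divr_gt0// weight_gt0. Qed.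

Lemma density_continuous : continuous k.
Proof. by move=> x; apply: cvgM; [exact: weight_continuous|exact: invr_continuous]. Qed.

(** Continuity of k lets a unit mass spread over [c, d] act almost as the point
    mass at c does. *)
Lemma density_near_right c (theta : R) : theta < 1 ->
  exists2 d, c < d & forall t, c <= t <= d -> theta * k c <= k t.
Proof.
move=> th1; have lt_k : theta * k c < k c by rewrite gtr_pMl// density_gt0.
have /cvgr_ge/(_ _ lt_k) := @density_continuous c.
move=> /nbhs_ballP[e /= e0 H]; exists (c + e / 2); first by rewrite ltrDl divr_gt0.
move=> t /andP[ct td]; apply: H; rewrite /ball/= ltr_norml; lra.
Qed.

Lemma locint_density f : in_L1 f -> locint (fun x => k x * f x).
Proof. by move=> /locint_L1; apply: locint_mul_continuous density_continuous. Qed.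

Lemma is_derive_potential : {ae mu, forall x, is_derive x 1 Q (p x)}.
Proof. by apply: ae_imply (primitive_derivable locint_qr) => x /is_derive1P. Qed.

Lemma measurable_qr : measurable_fun setT p.
Proof. exact: locint_measurable locint_qr. Qed.

Lemma integral_qr_abs (D : set R) : measurable D ->
  (\int[mu]_(t in D) (p t)%:E = \int[mu]_(t in D) `|(p t)%:E|)%E.
Proof.
move=> mD; apply: ae_eq_integral => //.
- by apply/measurable_EFinP; exact: measurable_funTS measurable_qr.
- apply: measurableT_comp => //.
  by apply/measurable_EFinP; exact: measurable_funTS measurable_qr.
- by apply: ae_imply qr_ge0 => x px _ /=; rewrite ger0_norm.
Qed.

Lemma potential0 : Q 0 = 0. Proof. by rewrite /Q /primitive subrr. Qed.

(** The absolute value replaces the almost everywhere sign of q by an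
    everywhere one, which monotonicity in the domain of integration asks for. *)
Lemma potentialN_integral x : x <= 0 -> ((- Q x)%:E = \int[mu]_(t in `[x, 0%R]) `|(p t)%:E|)%E.
Proof.
move=> x0; rewrite -[in LHS](sub0r (Q x)) -[X in (X - _)%:E]potential0.
rewrite /Q primitiveB//; last exact: locint_qr.
rewrite -integral_qr_abs// /Rintegral fineK//.
by apply: integrable_fin_num => //; exact: locint_itv locint_qr.
Qed.

(** W y + int k f is absolutely continuous, and its derivative is
    W (y' - (q / r) y + f / r), which the equation makes zero almost
    everywhere. *)
Lemma solution_weighted f y a b : in_L1 f -> is_solution r q f y -> a <= b ->
  W a * y a - W b * y b = \int[mu]_(t in `[a, b]) (k t * f t).
Proof.
move=> L1f [acy aey _ _] ab.
rewrite -primitiveB//; last exact: locint_density.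
set F := primitive _.
have dF : {ae mu, forall x, is_derive x 1 F (k x * f x)}.
  by apply: ae_imply (primitive_derivable (locint_density L1f)) => x /is_derive1P.
pose H x := W x * y x + F x.
have shuffle (A B C D : R) : A + B = C + D -> C - A = B - D by lra.
suff : H b = H a by exact: shuffle.
apply: ac_derive0_cst => //.
  apply: ac_add; last exact: (primitive_ac (locint_density L1f)).
  by apply: ac_mul => // u v; exact: weight_ac.
have dFQ := ae_imply2 (fun x => @conj _ _) dF is_derive_potential.
refine (ae_imply2 _ dFQ aey).
move=> x [dFx dQ] [dy eqy]; apply/is_derive1P.
have dW : is_derive x 1 W (W x * - p x).
  by apply: is_derive_expR_comp; exact: is_deriveN.
have dy' : is_derive x 1 y (derive1 y x) by apply/is_derive1P.
have := is_deriveD (is_deriveM dW dy') dFx.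
move=> H1; apply: is_derive_eq H1 _.
rewrite -eqy /k /p /GRing.scale/=; field.
by rewrite gt_eqF.
Qed.

(** W is nonincreasing, hence bounded near +oo. *)
Lemma weighted_cvg0 y : y x @[x --> +oo] --> 0 -> W x * y x @[x --> +oo] --> 0.
Proof.
move=> y0; apply/cvgr0Pnorm_lt => e e0.
have eW : 0 < e / W 0 by rewrite divr_gt0 ?weight_gt0.
move/cvgr0Pnorm_lt : y0 => /(_ _ eW) H.
near=> x.
rewrite normrM gtr0_norm ?weight_gt0//.
have Wx : W x <= W 0 by apply: weight_nonincreasing; near: x; exact/nbhs_pinfty_ge/num_real.
apply: (le_lt_trans (ler_wpM2r _ Wx)) => //.
rewrite mulrC -ltr_pdivlMr ?weight_gt0//.
by near: x.
Unshelve. all: by end_near. Qed.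

(** As W y -> 0 at +oo, W(x) y(x) is the whole integral of k f >= 0 over
    [x, +oo), hence at least its part over [c, d]. *)
Lemma solution_lower_bound f y m c d x : in_L1 f -> (forall t, 0 <= f t) ->
  is_solution r q f y -> 0 <= m -> c <= d -> (forall t, c <= t <= d -> m <= k t) ->
  x <= c -> m * \int[mu]_(t in `[c, d]) f t <= W x * y x.
Proof.
move=> L1f f0 sy m0 cd mk xc.
have lkf := locint_density L1f.
apply: (@le_trans _ _ (\int[mu]_(t in `[c, d]) (k t * f t))).
  rewrite -RintegralZl//; last exact: locint_itv (locint_L1 L1f).
  apply: le_Rintegral => //.
  - have := locint_itv c d (locint_mul_continuous (@cst_continuous _ _ m) (locint_L1 L1f)).
    exact.
  - exact: locint_itv.
  - by move=> t /=; rewrite in_itv/= => tcd; rewrite ler_wpM2r// mk.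
set I := Rintegral _ _ _.
have Ib b : d <= b -> I <= W x * y x - W b * y b.
  move=> db; rewrite (solution_weighted L1f sy); last by lra.
  rewrite -primitiveB//; last by lra.
  rewrite /I -primitiveB//.
  have F b1 b2 : b1 <= b2 -> primitive (fun t => k t * f t) b1 <= primitive (fun t => k t * f t) b2.
    apply: primitive_nondecreasing => //.
    by apply: aeW => t; rewrite mulr_ge0// ltW// density_gt0.
  by apply: lerB; exact: F.
have [_ _ _ /weighted_cvg0 Wy] := sy.
have : (fun b => W x * y x - W b * y b) @ +oo --> W x * y x - 0.
  by apply: cvgB => //; exact: cvg_cst.
rewrite subr0 => lim_; rewrite -(cvg_lim (@Rhausdorff _) lim_).
apply: limr_ge; first by apply/cvg_ex; exists (W x * y x).
by near=> b; apply: Ib; near: b; exact/nbhs_pinfty_ge/num_real.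
Unshelve. all: by end_near. Qed.

(** W (y - z) is constant and tends to 0 at +oo. *)
Lemma solution_unique f y z : in_L1 f -> is_solution r q f y ->
  is_solution r q f z -> y = z.
Proof.
move=> L1f sy sz; apply/funext => x.
have E b : x <= b -> W x * y x - W b * y b = W x * z x - W b * z b.
  by move=> xb; rewrite (solution_weighted L1f sy)// (solution_weighted L1f sz).
have shuffle (A B C D : R) : A - B = C - D -> B - D = A - C by lra.
have [_ _ _ /weighted_cvg0 Wy] := sy.
have [_ _ _ /weighted_cvg0 Wz] := sz.
have : (fun b => W b * y b - W b * z b) @ +oo --> (0 : R) - 0 by exact: cvgB.
rewrite subr0 => l0.
have : (fun b => W b * y b - W b * z b) @ +oo --> W x * y x - W x * z x.
  apply: cvg_near_cst; near=> b; have xb : x <= b by near: b; exact/nbhs_pinfty_ge/num_real.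
  by apply: shuffle; exact: E.
move=> /cvg_lim -/(_ (@Rhausdorff _)); rewrite (cvg_lim (@Rhausdorff _) l0).
by have := weight_gt0 x; nra.
Unshelve. all: by end_near. Qed.

(** * The operator G and its norm *)

(** Extended by zero off the half-plane z.1 <= z.2, so that the product measure
    of the whole plane can be used. *)
Definition Gkernel f (z : R * R) : R :=
  if z.1 <= z.2 then (W z.1)^-1 * (k z.2 * f z.2) else 0.

Lemma measurable_Gkernel f : measurable_fun setT f -> measurable_fun setT (Gkernel f).
Proof.
move=> mf; apply: measurable_fun_ifT.
- by apply: measurable_fun_ler; [exact: measurable_fst|exact: measurable_snd].
- apply: measurable_funM.
    apply: (measurableT_comp (f := fun x => (W x)^-1)); last exact: measurable_fst.
    exact: measurable_weightV.
  apply: (measurableT_comp (f := fun x => k x * f x)); last exact: measurable_snd.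
  apply: measurable_funM => //; apply: continuous_measurable_fun; exact: density_continuous.
- exact: measurable_cst.
Qed.

Lemma measurable_abs_Gkernel f : measurable_fun setT f ->
  measurable_fun setT (fun z => `|(Gkernel f z)%:E|%E).
Proof.
move=> mf; apply: (@measurableT_comp _ _ _ _ _ _ abse _ (EFin \o Gkernel f)) => //.
by apply/measurable_EFinP; exact: measurable_Gkernel.
Qed.

Lemma G_integrand_patchE f x :
  (EFin \o G_integrand r q f x) \_ `[x, +oo[ = fun t => (Gkernel f (x, t))%:E.
Proof.
apply/funext => t; rewrite patchE /Gkernel/= mem_setE in_itv/= andbT.
case: ifPn => // xt.
by rewrite /G_integrand expR_int_qr// /k; congr EFin; ring.
Qed.

Lemma GE f : G r q f = (fun x => \int[mu]_t (Gkernel f (x, t))%:E)%E.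
Proof. by apply/funext => x; rewrite /G integral_mkcond G_integrand_patchE. Qed.

Lemma M1_atE c :
  M1_at r q c = ((k c)%:E * \int[mu]_(x in `]-oo, c]) ((W x)^-1)%:E)%E.
Proof.
have mWV : measurable_fun `]-oo, c] (fun x => ((W x)^-1)%:E).
  by apply/measurable_EFinP; exact: measurable_weightV.
have WV0 x : (0 <= ((W x)^-1)%:E)%E by rewrite lee_fin invr_ge0 ltW// weight_gt0.
rewrite /M1_at [X in (_ * X)%E](_ : _ =
    \int[mu]_(x in `]-oo, c]) ((W c)%:E * ((W x)^-1)%:E))%E; last first.
  apply: eq_integral => x; rewrite inE/= in_itv/= => xc.
  by rewrite expR_int_qr// mulrC EFinM.
rewrite ge0_integralZl_EFin//; last by rewrite ltW// weight_gt0.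
by rewrite muleA -EFinM mulrC.
Qed.

Lemma M1_at_ge0 c : (0 <= M1_at r q c)%E.
Proof.
rewrite M1_atE mule_ge0//; first by rewrite lee_fin ltW// density_gt0.
by apply: integral_ge0 => x _; rewrite lee_fin invr_ge0 ltW// weight_gt0.
Qed.

Lemma M1_at_le c : (M1_at r q c <= M1 r q)%E.
Proof. by apply: ereal_sup_ubound; exists c. Qed.

Lemma M1_ltyP : (M1 r q < +oo)%E -> exists2 C, 0 <= C & M1 r q = C%:E.
Proof.
move=> fM; exists (fine (M1 r q)).
  by rewrite fine_ge0// (le_trans (M1_at_ge0 0))// M1_at_le.
by rewrite fineK// ge0_fin_numE// (le_trans (M1_at_ge0 0))// M1_at_le.
Qed.

(** Integrating the kernel in x for fixed t is what produces M_1(t). *)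
Lemma integral_abs_Gkernel_column f t :
  (\int[mu]_x `|(Gkernel f (x, t))%:E| = `|(f t)%:E| * M1_at r q t)%E.
Proof.
rewrite M1_atE.
transitivity (\int[mu]_(x in `]-oo, t]) ((k t * `|f t|)%:E * ((W x)^-1)%:E))%E.
  rewrite [RHS]integral_mkcond; apply: eq_integral => x _.
  rewrite patchE /Gkernel/= mem_setE in_itv/=.
  case: ifPn => xt; last by rewrite normr0.
  rewrite 2!normrM normfV (gtr0_norm (weight_gt0 x)) (gtr0_norm (density_gt0 t)).
  by rewrite -EFinM mulrC.
rewrite ge0_integralZl_EFin; last 4 first.
- by [].
- by move=> x _; rewrite lee_fin invr_ge0 ltW// weight_gt0.
- by apply/measurable_EFinP; exact: measurable_weightV.
- by rewrite mulr_ge0// ltW// density_gt0.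
by rewrite muleCA muleA.
Qed.

Lemma integral_abs_Gkernel f C : in_L1 f -> (forall t, M1_at r q t <= C%:E)%E ->
  (\int[mu]_x \int[mu]_t `|(Gkernel f (x, t))%:E| <= C%:E * norm1 (EFin \o f))%E.
Proof.
move=> L1f MC.
have mf := L1_measurable L1f.
have mK := measurable_abs_Gkernel mf.
rewrite (fubini_tonelli (m1 := mu) (m2 := mu) (fun z => `|(Gkernel f z)%:E|%E))//.
rewrite /norm1 Lnorm1 -ge0_integralZl//; last 2 first.
- by apply: measurableT_comp => //; exact/measurable_EFinP.
- by rewrite (le_trans (M1_at_ge0 0)).
apply: ge0_le_integral => //.
- by move=> t _; exact: integral_ge0.
- exact: (measurable_fun_fubini_tonelli_G (m1 := mu) (fun z => `|(Gkernel f z)%:E|%E)).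
- apply: emeasurable_funM => //.
  by apply: measurableT_comp => //; exact/measurable_EFinP.
- move=> t _; rewrite integral_abs_Gkernel_column muleC.
  by apply: lee_wpmul2r.
Qed.

Lemma integrable_Gkernel f : in_L1 f -> (M1 r q < +oo)%E ->
  (mu \x mu)%E.-integrable setT (EFin \o Gkernel f).
Proof.
move=> L1f /M1_ltyP[C C0 MC].
have mf := L1_measurable L1f.
have mK := measurable_Gkernel mf.
apply/integrable12ltyP; first exact/measurable_EFinP.
apply: (@le_lt_trans _ _ (C%:E * norm1 (EFin \o f))%E).
  by apply: integral_abs_Gkernel => // t; rewrite -MC M1_at_le.
rewrite lte_mul_pinfty//.
by rewrite /norm1 Lnorm1; case/integrableP: L1f.
Qed.

Lemma measurable_G_ge0 f : measurable_fun setT f -> (forall t, 0 <= f t) ->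
  measurable_fun setT (G r q f).
Proof.
move=> mf f0; rewrite GE.
apply: (measurable_fun_fubini_tonelli_F (m2 := mu) (EFin \o Gkernel f)).
  by apply/measurable_EFinP; exact: measurable_Gkernel.
move=> [x t]; rewrite /= lee_fin /Gkernel/=; case: ifPn => // _.
by rewrite !mulr_ge0 ?invr_ge0// ltW// ?weight_gt0// density_gt0.
Qed.

Lemma M1_G_maps_L1 : (M1 r q < +oo)%E -> G_maps_L1 r q.
Proof.
move=> fM f L1f; have iK := integrable_Gkernel L1f fM.
split.
  apply: ae_imply (ae_integrable1 iK) => x iKx.
  by rewrite integrable_mkcond// G_integrand_patchE.
by rewrite GE; exact: (integrable_fubini_F iK).
Qed.

Lemma G_norm_le f C : (M1 r q = C%:E)%E -> in_L1 f ->
  (norm1 (G r q f) <= C%:E * norm1 (EFin \o f))%E.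
Proof.
move=> MC L1f; have fM : (M1 r q < +oo)%E by rewrite MC ltry.
have mf := L1_measurable L1f.
have mK := measurable_Gkernel mf.
have [_ /integrableP[mG _]] := M1_G_maps_L1 fM L1f.
apply: le_trans (integral_abs_Gkernel L1f (C := C) _); last first.
  by move=> t; rewrite -MC M1_at_le.
rewrite {1}/norm1 Lnorm1; apply: ge0_le_integral => //.
- exact: measurableT_comp.
- apply: (measurable_fun_fubini_tonelli_F (m2 := mu) (fun z => `|(Gkernel f z)%:E|%E)) => //.
  exact: measurable_abs_Gkernel.
- move=> x _; rewrite GE; apply: le_abse_integral => //.
  apply/measurable_EFinP.
  apply: (measurableT_comp mK); exact: pair1_measurable.
Qed.

(** Together with M1_atE: a function that dominates theta k(c) / W to the left of c
    has norm at least theta M_1(c). *)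
Lemma norm1_ge_tail (h : R -> \bar R) c (s : R) : measurable_fun setT h -> 0 <= s ->
  (forall x, x <= c -> (((W x)^-1 * s)%:E <= `|h x|)%E) ->
  (s%:E * \int[mu]_(x in `]-oo, c]) ((W x)^-1)%:E <= norm1 h)%E.
Proof.
move=> mh s0 H; rewrite -ge0_integralZl_EFin//; last 2 first.
- by move=> x _; rewrite lee_fin invr_ge0 ltW// weight_gt0.
- by apply/measurable_EFinP; exact: measurable_weightV.
rewrite /norm1 Lnorm1.
apply: (@le_trans _ _ (\int[mu]_(x in `]-oo, c]) `|h x|)%E); last first.
  by apply: ge0_subset_integral => //; exact: measurableT_comp.
apply: ge0_le_integral => //.
- by move=> x _; rewrite -EFinM lee_fin mulr_ge0// invr_ge0 ltW// weight_gt0.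
- apply/measurable_EFinP; apply: measurable_funM => //.
  exact: measurable_weightV.
- by apply: measurable_funTS; exact: measurableT_comp.
- by move=> x /=; rewrite in_itv/= -EFinM mulrC; exact: H.
Qed.

Lemma G_lower_bound f m c d x : in_L1 f -> (forall t, 0 <= f t) ->
  0 <= m -> (forall t, c <= t <= d -> m <= k t) -> x <= c ->
  (((W x)^-1 * m * \int[mu]_(t in `[c, d]) f t)%:E <= G r q f x)%E.
Proof.
move=> L1f f0 m0 mk xc.
have mf := L1_measurable L1f.
have mK : measurable_fun setT (fun t => (Gkernel f (x, t))%:E).
  apply/measurable_EFinP.
  apply: (measurableT_comp (measurable_Gkernel mf)); exact: pair1_measurable.
have K0 t : (0 <= (Gkernel f (x, t))%:E)%E.
  rewrite lee_fin /Gkernel/=; case: ifPn => // _.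
  by rewrite !mulr_ge0 ?invr_ge0// ltW// ?weight_gt0// density_gt0.
rewrite GE; apply: (@le_trans _ _ (\int[mu]_(t in `[c, d]) (Gkernel f (x, t))%:E)%E); last first.
  exact: ge0_subset_integral.
have fcd : mu.-integrable `[c, d] (EFin \o f) by exact: integrableS L1f.
rewrite EFinM /Rintegral fineK; last exact: integrable_fin_num.
have s0 : 0 <= (W x)^-1 * m by rewrite mulr_ge0// invr_ge0 ltW// weight_gt0.
rewrite -ge0_integralZl_EFin//; last 2 first.
- by move=> t _; rewrite lee_fin.
- by apply/measurable_EFinP; exact: measurable_funTS.
apply: ge0_le_integral => //.
- by move=> t _; rewrite -EFinM lee_fin mulr_ge0.
- by apply/measurable_EFinP; apply: measurable_funM => //; exact: measurable_funTS.
- exact: measurable_funTS.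
- move=> t /=; rewrite in_itv/= => /andP[ct td].
  rewrite -EFinM lee_fin /Gkernel/= (le_trans xc ct) -mulrA ler_wpM2l//.
    by rewrite invr_ge0 ltW// weight_gt0.
  by rewrite ler_wpM2r// mk// ct.
Qed.

(** G is tested on a unit mass near c, at the price of a factor theta < 1 that is
    then let to 1; this covers M_1(c) = +oo as well. *)
Lemma M1_at_le_opnorm c : (M1_at r q c <= G_opnorm r q)%E.
Proof.
apply/lee_mul01Pr; first exact: M1_at_ge0.
move=> theta /andP[th0 th1].
have [d cd kd] := density_near_right c th1.
apply: (@le_trans _ _ (norm1 (G r q (bump c d)))); last first.
  apply: ereal_sup_ubound; exists (bump c d) => //.
  by split; [exact: bump_L1|rewrite norm1_bump].
have thk : 0 <= theta * k c by rewrite mulr_ge0 ?ltW// density_gt0.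
rewrite M1_atE muleA -EFinM.
have mG : measurable_fun setT (G r q (bump c d)).
  apply: measurable_G_ge0; last by move=> t; exact: bump_ge0.
  exact: L1_measurable (bump_L1 c d).
apply: norm1_ge_tail => // x xc; apply: le_trans (lee_abs _).
have := G_lower_bound (bump_L1 c d) (fun t => bump_ge0 t cd) thk kd xc.
by rewrite Rintegral_bump// mulr1.
Qed.

Lemma G_opnormE : G_opnorm r q = M1 r q.
Proof.
apply/eqP; rewrite eq_le; apply/andP; split; last first.
  by apply: ge_ereal_sup => _ [c _ <-]; exact: M1_at_le_opnorm.
apply: ge_ereal_sup => _ [f [L1f nf] <-].
have [My|] := leP +oo%E (M1 r q); first by rewrite (le_trans (leey _)).
move=> /M1_ltyP[C C0 MC]; rewrite MC.
apply: (le_trans (G_norm_le MC L1f)).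
by rewrite -[leRHS]mule1 lee_wpmul2l// lee_fin.
Qed.

(** A bound on G bounds its operator norm, which is M_1. *)
Lemma G_boundedP : (M1 r q < +oo)%E <-> G_bounded r q.
Proof.
split=> [fM|[_ [C HC]]].
  split; first exact: M1_G_maps_L1.
  by have [C C0 MC] := M1_ltyP fM; exists C => f; exact: G_norm_le.
rewrite -G_opnormE.
(* The constant C of a bound need not be nonnegative. *)
apply: (@le_lt_trans _ _ (Num.max C 0)%:E); last exact: ltry.
apply: ge_ereal_sup => _ [f [L1f nf] <-].
apply: (le_trans (HC f L1f)).
apply: (@le_trans _ _ ((Num.max C 0)%:E * norm1 (EFin \o f))%E).
  by rewrite lee_wpmul2r ?lee_fin ?le_max ?lexx// /norm1 Lnorm1 integral_ge0.
rewrite -[leRHS]mule1 lee_wpmul2l// lee_fin.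
by rewrite le_max lexx orbT.
Qed.

(** * Necessity of the three conditions *)

(** If the integral is finite, W is bounded on (-oo, 0], and the solution for a unit
    mass near 0 stays above a positive constant there. *)
Lemma correctly_solvable_divergent : correctly_solvable r q ->
  (\int[mu]_(t in `]-oo, 0%R]) (q t / r t)%:E)%E = +oo%E.
Proof.
move=> [exu _]; apply: contrapT => fin.
have [d d0 kd] := density_near_right 0 (theta := 2^-1) ltac:(lra).
have L1f := bump_L1 0 d.
have [y [[sy _] _]] := exu _ L1f.
have [L HL] : exists L, forall x, x <= 0 -> - Q x <= L.
  exists (fine (\int[mu]_(t in `]-oo, 0%R]) `|(p t)%:E|)%E) => x x0.
  rewrite -lee_fin fineK; last first.
    rewrite ge0_fin_numE ?integral_ge0// -integral_qr_abs//.
    by rewrite ltey; apply/eqP.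
  rewrite potentialN_integral//; apply: ge0_subset_integral => //.
    by apply: measurableT_comp => //; apply/measurable_EFinP; exact: measurable_funTS measurable_qr.
  by move=> t /=; rewrite !in_itv/= => /andP[].
pose s := 2^-1 * k 0.
have s0 : 0 < s by rewrite mulr_gt0 ?density_gt0// invr_gt0.
have yl x : x <= 0 -> expR (- L) * s <= y x.
  move=> x0.
  have := solution_lower_bound L1f (fun t => bump_ge0 t d0) sy (ltW s0) (ltW d0) kd x0.
  rewrite Rintegral_bump// mulr1 mulrC -ler_pdivrMr ?weight_gt0// mulrC.
  apply: le_trans; rewrite ler_pM2r// weightV ler_expR lerNl.
  exact: HL.
have [_ _ yN _] := sy.
have e0 : 0 < expR (- L) * s by rewrite mulr_gt0// expR_gt0.
move/cvgr0Pnorm_lt : yN => /(_ _ e0) yN.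
have : \forall x \near -oo, (x : R) <= 0 by exact/nbhs_ninfty_le/num_real.
move=> xN; near (-oo : set_system R) => x.
have /yl : x <= 0 by near: x.
rewrite leNgt (le_lt_trans (ler_norm _))//.
by near: x.
Unshelve. all: by end_near. Qed.

(** The solution for a unit mass near c is at least k(c) / (2 W) to the left of c,
    and its norm is at most c_1. *)
Lemma correctly_solvable_M1_lty : correctly_solvable r q -> (M1 r q < +oo)%E.
Proof.
move=> [exu [C C0 HC]].
apply: (@le_lt_trans _ _ (2 * C)%:E); last exact: ltry.
apply: ge_ereal_sup => _ [c _ <-].
have [d cd kd] := density_near_right c (theta := 2^-1) ltac:(lra).
have L1f := bump_L1 c d.
have [y [[sy L1y] _]] := exu _ L1f.
pose s := 2^-1 * k c.
have s0 : 0 < s by rewrite mulr_gt0 ?density_gt0// invr_gt0.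
have : (2^-1%:E * M1_at r q c <= C%:E)%E.
  apply: (@le_trans _ _ (norm1 (EFin \o y))); last first.
    by rewrite (le_trans (HC _ _ L1f sy L1y))// norm1_bump// mule1.
  rewrite M1_atE muleA -EFinM; apply: norm1_ge_tail => //; first exact: measurable_int L1y.
    exact: ltW.
  move=> x xc; rewrite /= lee_fin (le_trans _ (ler_norm _))//.
  have := solution_lower_bound L1f (fun t => bump_ge0 t cd) sy (ltW s0) (ltW cd) kd xc.
  by rewrite Rintegral_bump// mulr1 mulrC -ler_pdivrMr ?weight_gt0// mulrC.
move=> /(lee_wpmul2l (_ : (0 <= 2%:E :> \bar R)%E)); rewrite lee_fin ler0n => /(_ isT).
by rewrite muleA -EFinM divff// mul1e EFinM.
Qed.

(** Gliding hump: masses 2^-(n+1) next to points where r < 2^-(n+1) have a finite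
    sum, yet each alone lifts the solution to 1/2. *)
Lemma correctly_solvable_inf_gt0 : correctly_solvable r q -> 0 < inf (range r).
Proof.
move=> [exu _]; rewrite ltNge; apply/negP => inf0.
pose c n : R := 1 / (2 ^ n.+1)%:R.
have c0 n : 0 < c n by rewrite divr_gt0// ltr0n expn_gt0.
have hinf : has_inf (range r).
  by split; [exists (r 0); exists 0|exists 0 => _ [x _ <-]; exact: ltW].
have /choice[a ra] : forall n, exists x, r x < c n.
  move=> n.
  have [_ [x _ <-] rx] := inf_adherent (c0 n) hinf.
  by exists x; rewrite (lt_le_trans rx)// gerDr.
have /choice[d dP] : forall n, exists x, a n < x /\
    forall t, a n <= t <= x -> 2^-1 * k (a n) <= k t.
  move=> n.
  by have [x ax kx] := density_near_right (a n) (theta := 2^-1) ltac:(lra); exists x.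
have ad n : a n < d n by have [] := dP n.
have csum : (\sum_(n <oo) (c n)%:E < +oo)%E.
  exact: le_lt_trans (epsilon_trick0 xpredT ler01) (ltry _).
have [f [L1f f0 fc]] := bump_series ad (fun n => ltW (c0 n)) csum.
have [y [[sy _] _]] := exu _ L1f.
have ya n : 2^-1 <= `|y (a n)|.
  have s0 : 0 <= 2^-1 * k (a n) by rewrite mulr_ge0 ?invr_ge0// ltW// density_gt0.
  have := solution_lower_bound L1f f0 sy s0 (ltW (ad n)) (dP n).2 (lexx _).
  move=> H; apply: le_trans (ler_norm _).
  rewrite -(ler_pM2l (weight_gt0 (a n))); apply: le_trans H.
  apply: (@le_trans _ _ (2^-1 * k (a n) * c n)); last by rewrite ler_wpM2l.
  rewrite mulrC -mulrA ler_pM2l ?invr_gt0// /k -mulrA ler_peMr//.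
    by rewrite ltW// weight_gt0.
  by rewrite ler_pdivlMl// mulr1 ltW.
have [_ _ yN yP] := sy.
have half0 : 0 < 2^-1 :> R by rewrite invr_gt0.
have [A A0 HA] := large_values_bounded half0 yN yP.
have [||t _ rt] := @EVT_min R r (- A) A; first lra.
  exact: continuous_subspaceT.
have [n cn] : exists n, c n < r t.
  have := near_infty_natSinv_expn_lt (PosNum (r_gt0 t)).
  move=> [N _ /(_ N (leqnn N)) /= HN]; exists N; apply: le_lt_trans HN.
  rewrite /c !div1r natrX lef_pV2 ?posrE ?exprn_gt0//.
  by rewrite ler_weXn2l// ler1n.
have /HA /andP[h1 h2] := ya n.
have := rt (a n); rewrite in_itv/= h1 h2 => /(_ isT).
by rewrite leNgt (lt_trans (ra n) cn).
Qed.

(** * Sufficiency of the three conditions *)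

(** 1 / W = exp Q is monotone, so it is enough to find one small value; if there
    is none, the integrals of q / r over [-n, 0] are bounded. *)
Lemma weightV_cvgNy :
  (\int[mu]_(t in `]-oo, 0%R]) (q t / r t)%:E)%E = +oo%E ->
  (W x)^-1 @[x --> -oo] --> 0.
Proof.
move=> div; apply/cvgr0Pnorm_lt => e e0.
suff [x0 x0e] : exists x, (W x)^-1 < e.
  have WVe x : x <= x0 -> `|(W x)^-1| < e.
    move=> xx0; rewrite weightV gtr0_norm; last exact: expR_gt0.
    by apply: le_lt_trans x0e; rewrite weightV ler_expR; exact: potential_nondecreasing.
  by near=> x; apply: WVe; near: x; exact/nbhs_ninfty_le/num_real.
apply: contrapT => /forallNP H.
have QL x : - Q x <= - ln e.
  rewrite lerN2 -ler_expR lnK ?posrE// -weightV leNgt; apply/negP; exact: H.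
have : (\int[mu]_(t in `]-oo, 0%R]) (q t / r t)%:E <= (- ln e)%:E)%E.
  rewrite (integral_qr_abs (measurable_itv _)).
  pose I (n : nat) : set R := [set` `[- n%:R, 0]].
  have -> : `]-oo, 0%R]%classic = \bigcup_n I n.
    apply/seteqP; split=> [x|x [n _]] /=; rewrite /I/= !in_itv/=; last by case/andP.
    move=> x0; exists (Num.truncn `|x|).+1 => //=; rewrite in_itv/= x0 andbT.
    by rewrite lerNl (le_trans (ler_norm _))// normrN ltW// truncnS_gt.
  have mp : measurable_fun setT (fun t => `|(p t)%:E|%E).
    by apply: measurableT_comp => //; apply/measurable_EFinP; exact: measurable_qr.
  have ndI : nondecreasing_seq I.
    apply/nondecreasing_seqP => n; rewrite subsetEset => t; rewrite /I/= !in_itv/=.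
    by move=> /andP[nt ->]; rewrite (le_trans _ nt)// lerN2 ler_nat.
  have mI n : measurable (I n) by exact: measurable_itv.
  have cvgI : (\int[mu]_(t in I n) `|(p t)%:E| @[n --> \oo] -->
      \int[mu]_(t in \bigcup_n I n) `|(p t)%:E|)%E.
    apply: ge0_nondecreasing_set_cvg_integral => //.
    by move=> n; exact: measurable_funTS.
  rewrite -(cvg_lim _ cvgI)//; apply: lime_le.
    by apply/cvg_ex; eexists; exact: cvgI.
  apply: nearW => n.
  by rewrite -potentialN_integral ?lee_fin// oppr_le0.
by rewrite div leye_eq.
Unshelve. all: by end_near. Qed.

Section sufficiency.
Hypothesis div : (\int[mu]_(t in `]-oo, 0%R]) (q t / r t)%:E)%E = +oo%E.
Hypothesis r0_gt0 : 0 < inf (range r).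
Hypothesis M1_lty : (M1 r q < +oo)%E.
Variable f : R -> R.
Hypothesis L1f : in_L1 f.

Let r0 := inf (range r).

Lemma inf_r_le x : r0 <= r x.
Proof.
apply: ge_inf; last by exists x.
by exists 0 => _ [t _ <-]; exact: ltW.
Qed.

(** This bounds the kernel k(t) / W(x) of G by 1 / r_0, uniformly in x <= t. *)
Lemma density_le x t : x <= t -> k t <= W x / r0.
Proof.
move=> xt; apply: ler_pM.
- by rewrite ltW// weight_gt0.
- by rewrite invr_ge0 ltW.
- exact: weight_nonincreasing.
by rewrite lef_pV2 ?posrE// inf_r_le.
Qed.

Lemma integrable_density x : mu.-integrable `[x, +oo[ (EFin \o (fun t => k t * f t)).
Proof.
have : mu.-integrable `[x, +oo[ (fun t => (W x / r0)%:E * (f t)%:E)%E.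
  by apply: integrableZl => //; exact: integrableS L1f.
apply: le_integrable => //.
  apply/measurable_EFinP; apply: measurable_funTS.
  exact: locint_measurable (locint_density L1f).
move=> t /=; rewrite in_itv/= andbT => xt; rewrite lee_fin (normrM (k t)) (normrM (W x / r0)).
rewrite ler_wpM2r// (gtr0_norm (density_gt0 t)) gtr0_norm ?density_le//.
by rewrite divr_gt0// weight_gt0.
Qed.

Definition tail x := \int[mu]_(t in `[x, +oo[) (k t * f t).

(** The values of G f, which are finite under the standing lower bound on r. *)
Definition greenf x := (W x)^-1 * tail x.

Lemma G_greenf x : G r q f x = (greenf x)%:E.
Proof.
rewrite /G /greenf /tail EFinM /Rintegral fineK; last first.
  by apply: integrable_fin_num => //; exact: integrable_density.
rewrite -integralZl//; last exact: integrable_density.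
apply: eq_integral => t; rewrite inE/= in_itv/= andbT => xt.
by rewrite /G_integrand expR_int_qr// /k -EFinM; congr EFin; ring.
Qed.

Lemma tailB a b : a <= b -> tail a - tail b = \int[mu]_(t in `[a, b]) (k t * f t).
Proof.
move=> ab.
have := @Rintegral_itvB R (fun t => k t * f t) (BLeft a) +oo%O b (integrable_density a).
rewrite !bnd_simp => /(_ ab isT).
rewrite Rintegral_itv_obnd_cbnd; last first.
  apply: (integrableS _ _ _ (integrable_density b)) => //.
  by apply: subset_itvr; rewrite bnd_simp.
by rewrite /tail => <-; ring.
Qed.

Lemma tailE x : tail x = tail 0 - primitive (fun t => k t * f t) x.
Proof.
have lkf := locint_density L1f.
have P0 : primitive (fun t => k t * f t) 0 = 0 by rewrite /primitive subrr.
have shuffle (A B C : R) : A - B = 0 - C -> A = B - C by lra.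
have shuffle' (A B C : R) : B - A = C - 0 -> A = B - C by lra.
have [x0|x0] := leP x 0.
  by apply: shuffle; rewrite tailB// -primitiveB// P0.
by apply: shuffle'; rewrite tailB ?ltW// -primitiveB// ?P0// ltW.
Qed.

Lemma tail_ac a b : a <= b -> absolutely_continuous a b tail.
Proof.
move=> ab; have acP := primitive_ac (locint_density L1f) ab.
apply: (ac_dominated ler01 acP acP) => u v _ _ _.
rewrite (tailE v) (tailE u) mul1r.
set A := primitive _ v; set B := primitive _ u.
have -> : tail 0 - A - (tail 0 - B) = - (A - B) by ring.
by rewrite normrN lerDl.
Qed.

Lemma greenf_equation : {ae mu, forall x, derivable greenf x 1 /\
  - r x * derive1 greenf x + q x * greenf x = f x}.
Proof.
have lkf := locint_density L1f.
have dP : {ae mu, forall x, is_derive x 1 (primitive (fun t => k t * f t)) (k x * f x)}.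
  by apply: ae_imply (primitive_derivable lkf) => x /is_derive1P.
refine (ae_imply2 _ dP is_derive_potential) => x dPx dQx.
have dW : is_derive x 1 (fun x => (W x)^-1) ((W x)^-1 * p x).
  by rewrite (eq_fun weightV) weightV; exact: is_derive_expR_comp.
have dt : is_derive x 1 tail (0 - k x * f x).
  rewrite (funext tailE); apply: is_deriveB.
have := is_deriveM dW dt.
move=> H.
have /is_derive1P[dg ->] : is_derive x 1 greenf (p x * greenf x - f x / r x).
  apply: is_derive_eq H _.
  rewrite /greenf /k /GRing.scale/=; field.
  by rewrite !gt_eqF// weight_gt0.
split=> //; rewrite /p; field.
by rewrite gt_eqF.
Qed.

(** Dominated convergence with the dominating function |f| / r_0; only pointwise
    decay of the kernel along u remains to be checked, and it has a different
    reason at each end of the line. *)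
Lemma greenf_cvg0 (u : nat -> R) :
  (forall t, Gkernel f (u n, t) @[n --> \oo] --> 0) -> greenf (u n) @[n --> \oo] --> 0.
Proof.
move=> u0.
have mf := L1_measurable L1f.
have [_ _] : [/\ mu.-integrable setT (cst 0%E : R -> \bar R),
    [sequence \int[mu]_t `|(Gkernel f (u n, t))%:E - 0|]_n @ \oo --> 0 &
    [sequence \int[mu]_t (Gkernel f (u n, t))%:E]_n @ \oo --> \int[mu]_(t in setT) 0]%E.
  apply: (@dominated_convergence _ _ _ mu setT measurableT
    (fun n t => (Gkernel f (u n, t))%:E) (cst 0%E) (fun t => r0^-1%:E * `|(f t)%:E|)%E).
  - move=> n; apply/measurable_EFinP.
    apply: (measurableT_comp (measurable_Gkernel mf)); exact: pair1_measurable.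
  - exact: measurable_cst.
  - by apply: aeW => t _; apply: cvg_EFin; [exact: nearW|exact: u0].
  - by apply: integrableZl => //; exact: integrable_abse.
  - apply: aeW => t n _; rewrite -EFinM lee_fin /Gkernel/=.
    case: ifPn => [ut|_]; last by rewrite normr0 mulr_ge0// invr_ge0 ltW.
    rewrite normrM (normrM (k t)) gtr0_norm ?invr_gt0 ?weight_gt0// mulrA.
    rewrite ler_wpM2r// (gtr0_norm (density_gt0 t)).
    by rewrite ler_pdivrMl ?weight_gt0// density_le.
rewrite integral0.
have -> : (fun n => \int[mu]_t (Gkernel f (u n, t))%:E)%E = EFin \o (greenf \o u).
  by apply/funext => n; rewrite /= -G_greenf GE.
by move=> /fine_cvgP[_].
Qed.

Lemma greenf_is_solution : is_solution r q f greenf.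
Proof.
split.
- by apply: ac_mul; [exact: weightV_ac|exact: tail_ac].
- exact: greenf_equation.
- apply/cvg_ninftyP => u uy; apply: greenf_cvg0 => t.
  (* At -oo the factor 1 / W(x) of the kernel tends to 0. *)
  have W0 : (W (u n))^-1 * `|k t * f t| @[n --> \oo] --> (0 : R).
    rewrite -[X in _ --> X](mul0r `|k t * f t|); apply: cvgM; last exact: cvg_cst.
    exact: cvg_comp uy (weightV_cvgNy div).
  apply/cvgr0Pnorm_lt => e e0; move/cvgr0Pnorm_lt : W0 => /(_ _ e0).
  apply: filterS => n; apply: le_lt_trans; rewrite /Gkernel/=.
  case: ifPn => [_|_]; last by rewrite normr0.
  by rewrite [leLHS]normrM [leRHS]normrM normr_id.
- apply/cvg_pinftyP => u uy; apply: greenf_cvg0 => t.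
  (* At +oo the kernel vanishes as soon as u n exceeds t. *)
  apply: cvg_near_cst; near=> n; rewrite /Gkernel/= leNgt ifF//.
  apply/negbF; near: n.
  by move/cvgryPgt : uy; apply.
Unshelve. all: by end_near. Qed.

Lemma greenf_L1 : in_L1 greenf.
Proof.
have [_] := M1_G_maps_L1 M1_lty L1f.
by rewrite (funext G_greenf).
Qed.

End sufficiency.

Lemma correctly_solvable_sufficient :
  (\int[mu]_(t in `]-oo, 0%R]) (q t / r t)%:E)%E = +oo%E ->
  0 < inf (range r) -> (M1 r q < +oo)%E -> correctly_solvable r q.
Proof.
move=> div r0 fM; split.
  move=> f L1f; exists (greenf f); split.
    by split; [exact: greenf_is_solution|exact: greenf_L1].
  move=> y [sy _]; apply: (solution_unique L1f _ sy); exact: greenf_is_solution.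
have [C C0 MC] := M1_ltyP fM; exists (C + 1); first lra.
move=> f y L1f sy _.
have -> : y = greenf f by apply: (solution_unique L1f sy); exact: greenf_is_solution.
have -> : EFin \o greenf f = G r q f by apply/funext => x; rewrite G_greenf.
apply: (le_trans (G_norm_le MC L1f)).
rewrite lee_wpmul2r//; first by rewrite /norm1 Lnorm1 integral_ge0.
by rewrite lee_fin lerDl.
Qed.

End problem.

(** * The characterization *)

Theorem theorem2p5 (R : realType) (r q : R -> R)
    (r_cont : continuous r) (r_gt0 : forall x : R, 0 < r x)
    (q_loc : locally_integrable [set: R] q)
    (q_ge0 : {ae (@lebesgue_measure R), forall x, 0 <= q x}) :
  (correctly_solvable r q <->
     [/\ (\int[@lebesgue_measure R]_(t in `]-oo, 0%R]) (q t / r t)%:E)%E = +oo%E,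
         0 < inf (range r)
       & (M1 r q < +oo)%E]) /\
  ((M1 r q < +oo)%E <-> G_bounded r q) /\
  G_opnorm r q = M1 r q.
Proof.
split; last by split; [exact: G_boundedP|exact: G_opnormE].
split=> [cs|[div r0 fM]]; last exact: correctly_solvable_sufficient.
split.
- exact: (correctly_solvable_divergent r_cont r_gt0 q_loc q_ge0 cs).
- exact: (correctly_solvable_inf_gt0 r_cont r_gt0 q_loc q_ge0 cs).
- exact: (correctly_solvable_M1_lty r_cont r_gt0 q_loc q_ge0 cs).
Qed.
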